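(* Let $\{A_\rho\}_{\rho\in\mathcal R}$ with $A_\rho\in\mathcal B(H_\rho)$ be a bounded density-dependent operator family, let $\rho\mapsto\widetilde A_\rho$ be an extension policy for it, and let $$\mathbb A:\mathcal H\times\mathcal R\to\mathcal H\times\mathcal R,\qquad \mathbb A(u,\rho)=(\widetilde A_\rho u,\rho)$$ be the induced map. Then $\mathbb A$ is continuous on $\mathcal H\times\mathcal R$ if and only if $\rho\mapsto\widetilde A_\rho$ is strongly continuous.
   Context: Let $X=\mathbb R^n$ ($n\ge 1$) with its Borel $\sigma$-algebra and Lebesgue measure $\lambda$; functions are complex-valued. Let $\mathcal H=L^2(X,\lambda)$ with norm $\|\cdot\|_2$; $\mathcal B(E)$ denotes the bounded linear operators on $E$. Let $\mathcal R=\{\rho\in L^1(X,\lambda):\rho\ge 0\ \lambda\text{-a.e.},\ \int_X\rho\,d\lambda=1\}$ with the $L^1$-metric. For $\rho\in\mathcal R$ let $H_\rho=L^2(X,\rho\,d\lambda)$ and $V_\rho=\{u\in\mathcal H:u=0\ \lambda\text{-a.e. on }\{\rho=0\}\}$. The map $U_\rho:H_\rho\to V_\rho$, $U_\rho[f]_\rho=\sqrt\rho\,f$, is unitary. For $A_\rho\in\mathcal B(H_\rho)$ let $A_\rho^\sharp=U_\rho A_\rho U_\rho^{-1}:V_\rho\to V_\rho$. An extension policy for $\{A_\rho\}_{\rho\in\mathcal R}$ is a choice, for every $\rho\in\mathcal R$, of an operator $\widetilde A_\rho\in\mathcal B(\mathcal H)$ with $\widetilde A_\rho|_{V_\rho}=A_\rho^\sharp$.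 The policy is strongly continuous if $\rho_k\to\rho$ in $L^1$ (with $\rho_k,\rho\in\mathcal R$) implies $\widetilde A_{\rho_k}u\to\widetilde A_\rho u$ in $\mathcal H$ for every fixed $u\in\mathcal H$. The space $\mathcal H\times\mathcal R$ carries the metric $d_\oplus((u,\rho),(v,\sigma))=\|u-v\|_2+\|\rho-\sigma\|_1$. *)

(* Defs.v *)
From HB Require Import structures.
From mathcomp Require Import all_boot all_order all_algebra.
From mathcomp Require Import generic_quotient ring_quotient complex.
From mathcomp Require Import all_classical all_reals all_analysis.
From mathcomp Require Import measurable_realfun.

Set Implicit Arguments.
Unset Strict Implicit.
Unset Printing Implicit Defensive.

Import Order.TTheory GRing.Theory Num.Theory.
Import numFieldNormedType.Exports.

Local Open Scope classical_set_scope.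
Local Open Scope ring_scope.
Local Open Scope complex_scope.
Local Open Scope quotient_scope.

(* The real-valued modulus: `|z| : R[i] is convertible to (normc z)%:C. *)
Notation normc := Normc.normc.

Section complex_L2.
Context d (T : measurableType d) (R : realType).
Variable mu : {measure set T -> \bar R}.
Implicit Types f g : T -> R[i].

Definition L2norm_fun f : \bar R := Lnorm mu 2%:E (fun x => (normc (f x))%:E).

(* A complex function is (Borel) measurable iff its real and imaginary parts
   are. *)
Definition L2_fun : {pred T -> R[i]} := fun f =>
  `[< [/\ measurable_fun setT (fun x => complex.Re (f x)),
          measurable_fun setT (fun x => complex.Im (f x)) &
          (L2norm_fun f < +oo)%E] >].

Lemma normcE2 (z : R[i]) :
  normc z = Num.sqrt (complex.Re z ^+ 2 + complex.Im z ^+ 2).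
Proof. by case: z. Qed.

Lemma normc_ge0 (z : R[i]) : 0 <= normc z.
Proof. by rewrite normcE2 sqrtr_ge0. Qed.

Lemma measurable_normc f :
    measurable_fun setT (fun x => complex.Re (f x)) ->
    measurable_fun setT (fun x => complex.Im (f x)) ->
  measurable_fun setT (fun x => normc (f x)).
Proof.
move=> mR mI.
under eq_fun do rewrite normcE2 -powR12_sqrt ?addr_ge0 ?sqr_ge0//.
apply: (measurableT_comp (measurable_powR _)).
by apply: measurable_funD; exact: measurable_funX.
Qed.

Lemma L2_funP f : reflect [/\ measurable_fun setT (fun x => complex.Re (f x)),
  measurable_fun setT (fun x => complex.Im (f x)) &
          (L2norm_fun f < +oo)%E] (f \in L2_fun).
Proof. exact: asboolP. Qed.

Lemma ReD (z w : R[i]) : complex.Re (z + w) = complex.Re z + complex.Re w.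
Proof. by case: z; case: w. Qed.
Lemma ImD (z w : R[i]) : complex.Im (z + w) = complex.Im z + complex.Im w.
Proof. by case: z; case: w. Qed.
Lemma ReM (z w : R[i]) :
  complex.Re (z * w) = complex.Re z * complex.Re w - complex.Im z * complex.Im w.
Proof. by case: z; case: w. Qed.
Lemma ImM (z w : R[i]) :
  complex.Im (z * w) = complex.Re z * complex.Im w + complex.Im z * complex.Re w.
Proof. by case: z; case: w. Qed.

Lemma L2norm_funE f :
  L2norm_fun f = ((\int[mu]_x (normc (f x) ^+ 2)%:E) `^ 2^-1)%E.
Proof.
rewrite /L2norm_fun unlock /Lnorm; congr (_ `^ _)%E.
apply: eq_integral => x _.
by rewrite abse_EFin poweR_EFin powR_mulrn// ger0_norm ?normc_ge0.
Qed.

Lemma measurable_normc2 f : f \in L2_fun ->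
  measurable_fun setT (fun x => (normc (f x) ^+ 2)%:E).
Proof.
move=> /L2_funP[mR mI _]; apply/measurable_EFinP.
by apply: measurable_funX; exact: measurable_normc.
Qed.

Lemma L2norm_funZ (a : R[i]) f : f \in L2_fun ->
  L2norm_fun (fun x => a * f x) = ((normc a)%:E * L2norm_fun f)%E.
Proof.
move=> /measurable_normc2 mf; rewrite !L2norm_funE.
under eq_integral => x _ do rewrite Normc.normcM exprMn EFinM.
rewrite ge0_integralZl//; last 2 first.
- by move=> x _; rewrite lee_fin sqr_ge0.
- by rewrite lee_fin sqr_ge0.
rewrite poweRM ?lee_fin ?sqr_ge0//; last first.
  by apply: integral_ge0 => x _; rewrite lee_fin sqr_ge0.
by rewrite poweR_EFin powR12_sqrt ?sqr_ge0// sqrtr_sqr ger0_norm ?normc_ge0.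
Qed.

Lemma L2norm_funD f g : f \in L2_fun -> g \in L2_fun ->
  (L2norm_fun (fun x => f x + g x)%R <= L2norm_fun f + L2norm_fun g)%E.
Proof.
move=> /L2_funP[mRf mIf _] /L2_funP[mRg mIg _].
have mf := measurable_normc mRf mIf.
have mg := measurable_normc mRg mIg.
have := @minkowski_EFin _ _ _ mu _ _ 2 mf mg.
rewrite ler1n => /(_ isT); apply: le_trans.
rewrite L2norm_funE unlock /Lnorm gt0_ler_poweR//.
- by rewrite in_itv/= leey integral_ge0// => x _; rewrite lee_fin sqr_ge0.
- by rewrite in_itv/= leey integral_ge0// => x _; rewrite lee_fin powR_ge0.
apply: ge0_le_integral => //=.
- by move=> x _; rewrite lee_fin sqr_ge0.
- apply/measurable_EFinP/measurable_funX; apply: measurable_normc.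
    by under eq_fun do rewrite ReD; exact: measurable_funD.
  by under eq_fun do rewrite ImD; exact: measurable_funD.
- apply/measurable_EFinP; apply: (measurableT_comp (measurable_powR _)).
  by apply: measurableT_comp => //; exact: measurable_funD.
move=> x _; rewrite lee_fin powR_mulrn// lerXn2r ?nnegrE ?normc_ge0//.
by rewrite (le_trans (le_normcD _ _))// ler_norm.
Qed.

Lemma L2norm_fun_ge0 f : (0 <= L2norm_fun f)%E.
Proof. exact: Lnorm_ge0. Qed.

Lemma L2_submod_closed : submod_closed (L2_fun : {pred T -> R[i]^o}).
Proof.
split.
  apply/L2_funP; split => //.
  rewrite L2norm_funE integral0_eq// => [|x _].
    by rewrite poweR0r.
  by rewrite Normc.normc0 expr0n.
move=> a f g fL gL; have /L2_funP[mRf mIf ff] := fL.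
have /L2_funP[mRg mIg fg] := gL.
have afL : (fun x => a * f x) \in L2_fun.
  apply/L2_funP; split.
  - under eq_fun do rewrite ReM.
    by apply: measurable_funB; exact: measurable_funM.
  - under eq_fun do rewrite ImM.
    by apply: measurable_funD; exact: measurable_funM.
  - rewrite L2norm_funZ// lte_mul_pinfty ?lee_fin ?normc_ge0//.
have /L2_funP[mRaf mIaf faf] := afL.
apply/L2_funP; split.
- by under eq_fun do rewrite ReD; exact: measurable_funD.
- by under eq_fun do rewrite ImD; exact: measurable_funD.
- by rewrite (le_lt_trans (L2norm_funD afL gL))// lte_add_pinfty.
Qed.

HB.instance Definition _ :=
  GRing.isSubmodClosed.Build _ _ L2_fun L2_submod_closed.

Record L2fun := MkL2fun { L2fun_val :> T -> R[i]^o; L2fun_valP : L2fun_val \in L2_fun }.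
HB.instance Definition _ := [isSub for L2fun_val].
HB.instance Definition _ := [Choice of L2fun by <:].
HB.instance Definition _ := [SubChoice_isSubLmodule of L2fun by <:].

Lemma L2fun_lin (a : R[i]) (h k : L2fun) x : (a *: h + k) x = a * h x + k x.
Proof. by []. Qed.

Lemma L2funZ (a : R[i]) (h : L2fun) x : (a *: h) x = a * h x.
Proof. by []. Qed.

Definition L2null : {pred L2fun} := fun h => `[< {ae mu, forall x, h x = 0} >].

Lemma L2nullP (h : L2fun) : reflect {ae mu, forall x, h x = 0} (h \in L2null).
Proof. exact: asboolP. Qed.

Lemma L2null_submod_closed : submod_closed L2null.
Proof.
split; first by apply/L2nullP; exact: nearW.
move=> a f g /L2nullP f0 /L2nullP g0; apply/L2nullP.
by apply: filterS2 f0 g0 => x fx gx; rewrite L2fun_lin fx gx mulr0 addr0.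
Qed.

HB.instance Definition _ :=
  GRing.isSubmodClosed.Build _ _ L2null L2null_submod_closed.

(* L^2(T, mu; C): square-integrable functions modulo a.e. equality (L2_eqP). *)
Definition L2 := Quotient.quot L2null.
HB.instance Definition _ := GRing.Zmodule.on L2.
HB.instance Definition _ := EqQuotient.on L2.

Definition L2_to_fun (u : L2) : T -> R[i] := L2fun_val (repr u).

Lemma L2_eqP (h k : L2fun) :
  \pi_L2 h = \pi_L2 k <-> {ae mu, forall x, h x = k x}.
Proof.
have sub x : (h - k) x = h x - k x by [].
split=> [/eqP|hk].
  rewrite -Quotient.idealrBE => /L2nullP; apply: filterS => x.
  by rewrite sub => /subr0_eq.
apply/eqP; rewrite -Quotient.idealrBE; apply/L2nullP.
by apply: filterS hk => x; rewrite sub => ->; rewrite subrr.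
Qed.

Lemma L2_reprE (h : L2fun) : {ae mu, forall x, L2_to_fun (\pi_L2 h) x = h x}.
Proof. by apply/L2_eqP; rewrite reprK. Qed.

Definition L2_scale (a : R[i]) (u : L2) : L2 := \pi_L2 (a *: repr u).

Lemma L2_pi_scale a (h : L2fun) : L2_scale a (\pi_L2 h) = \pi_L2 (a *: h).
Proof.
apply/L2_eqP; apply: filterS (L2_reprE h) => x hx.
by rewrite !L2funZ -hx.
Qed.

Lemma L2_scaleA a b u : L2_scale a (L2_scale b u) = L2_scale (a * b) u.
Proof. by rewrite L2_pi_scale scalerA. Qed.

Lemma L2_scale1 : left_id 1 L2_scale.
Proof. by move=> u; rewrite /L2_scale scale1r reprK. Qed.

Lemma L2_scaleDr : right_distributive L2_scale +%R.
Proof.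
move=> a u v; rewrite -[u]reprK -[v]reprK -raddfD.
by rewrite !L2_pi_scale scalerDr raddfD.
Qed.

Lemma L2_scaleDl u : {morph L2_scale^~ u : a b / a + b}.
Proof. by move=> a b; rewrite /L2_scale scalerDl raddfD. Qed.

HB.instance Definition _ := GRing.Zmodule_isLmodule.Build R[i] L2
  L2_scaleA L2_scale1 L2_scaleDr L2_scaleDl.

Lemma L2_to_fun_lin (a : R[i]) (u v : L2) :
  {ae mu, forall x, L2_to_fun (a *: u + v) x = a * L2_to_fun u x + L2_to_fun v x}.
Proof.
have -> : a *: u + v = \pi_L2 (a *: repr u + repr v) by rewrite raddfD /= reprK.
exact: L2_reprE.
Qed.

Lemma L2_to_fun_inj (u v : L2) :
  {ae mu, forall x, L2_to_fun u x = L2_to_fun v x} -> u = v.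
Proof. by move=> uv; rewrite -[u]reprK -[v]reprK; exact/L2_eqP. Qed.

Definition L2norm (u : L2) : R := fine (L2norm_fun (L2_to_fun u)).

Lemma L2norm_fun_ae f g : f \in L2_fun -> g \in L2_fun ->
  {ae mu, forall x, f x = g x} -> L2norm_fun f = L2norm_fun g.
Proof.
move=> fL gL fg; rewrite !L2norm_funE; congr (_ `^ _)%E.
apply: ae_eq_integral => //; [exact: measurable_normc2..|].
by apply: filterS fg => x -> _.
Qed.

Lemma L2norm_pi (h : L2fun) : (L2norm (\pi_L2 h))%:E = L2norm_fun h.
Proof.
have hL := L2fun_valP h.
have hL' := L2fun_valP (repr (\pi_L2 h)).
rewrite /L2norm fineK; first exact: L2norm_fun_ae (L2_reprE h).
rewrite ge0_fin_numE ?L2norm_fun_ge0//.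
by have /L2_funP[] := hL'.
Qed.

Definition L2_norm (u : L2) : R[i] := (L2norm u)%:C.

Lemma L2_ler_normD u v : L2_norm (u + v) <= L2_norm u + L2_norm v.
Proof.
rewrite -rmorphD lecR -lee_fin EFinD.
rewrite -[u]reprK -[v]reprK -raddfD !L2norm_pi.
exact: L2norm_funD (L2fun_valP _) (L2fun_valP _).
Qed.

Lemma L2_normrZ a u : L2_norm (a *: u) = `|a| * L2_norm u.
Proof.
rewrite /L2_norm -[`|a|]/((normc a)%:C) -rmorphM; congr (_%:C).
apply: EFin_inj; rewrite EFinM -[in RHS](reprK u) !L2norm_pi.
exact: L2norm_funZ (L2fun_valP _).
Qed.

Lemma L2_normr0_eq0 u : L2_norm u = 0 -> u = 0.
Proof.
rewrite -[u]reprK; move: (repr u) => h [h0].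
have u0 : L2norm_fun h = 0%E by rewrite -L2norm_pi h0.
have -> : 0 = \pi_L2 0 by rewrite raddf0.
apply/L2_eqP.
have /L2_funP[mR mI _] := L2fun_valP h.
have := @Lnorm_eq0_eq0 _ _ _ mu _ _ _ _ u0.
move/measurable_EFinP: (measurable_normc mR mI) => mh /(_ mh).
rewrite lte_fin ltr0n => /(_ isT); apply: filterS => x /(_ I)[].
exact: Normc.eq0_normc.
Qed.

HB.instance Definition _ := Lmodule_isNormed.Build R[i] L2
  L2_ler_normD L2_normrZ L2_normr0_eq0.

Lemma L2_normE (u : L2) : `|u| = (L2norm u)%:C.
Proof. by []. Qed.

Lemma L2norm_ge0 (u : L2) : 0 <= L2norm u.
Proof. by rewrite -lecR; exact: (normr_ge0 u). Qed.

End complex_L2.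


Section density.
Context d (T : measurableType d) (R : realType).
Variable mu : {measure set T -> \bar R}.

Record density := Density {
  density_L1 :> LspaceType mu (@lexx _ _ 1%E) ;
  density_ge0 : {ae mu, forall x, 0 <= density_L1 x} ;
  density_int1 : (\int[mu]_x (density_L1 x)%:E = 1)%E }.

HB.instance Definition _ := gen_eqMixin density.
HB.instance Definition _ := gen_choiceMixin density.

Definition L1dist (r s : density) : R :=
  fine (Lnorm mu 1%:E (fun x => (r x - s x)%:E)).

Lemma measurable_density (r : density) : measurable_fun setT (r : T -> R).
Proof. exact: measurable_funPT (repr (r : {mfun_ mu, T >-> measurableTypeR R})). Qed.

Lemma density_integrable (r : density) : mu.-integrable setT (EFin \o r).
Proof.
apply/Lfun1_integrable; rewrite inE; apply/andP; split; rewrite inE/=.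
  exact: measurable_density.
exact: (@Lebesgue_finite _ _ _ _ _ _ (density_L1 r)).
Qed.

Lemma densityP (r s : density) : {ae mu, forall x, r x = s x} -> r = s.
Proof.
move=> rs.
have e : density_L1 r = density_L1 s :> {mfun_ mu, T >-> measurableTypeR R}.
  rewrite -[LHS]reprK -[RHS]reprK; apply/eqP; rewrite eqmodE.
  by apply/asboolP; exact: filterS rs.
case: r s rs e => [[f [[Hf]]] r0 r1] [[g [[Hg]]] s0 s1] /= _ e.
subst g; rewrite (Prop_irrelevance Hg Hf) in s0 s1 *.
by rewrite (Prop_irrelevance s0 r0) (Prop_irrelevance s1 r1).
Qed.

Lemma L1distE (r s : density) :
  (L1dist r s)%:E = (\int[mu]_x `|r x - s x|%:E)%E.
Proof.
rewrite /L1dist Lnorm1 fineK//; apply: integrable_fin_num => //.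
apply: integrable_abse.
exact: (integrableB _ (density_integrable r) (density_integrable s)).
Qed.

Lemma L1dist_ge0 (r s : density) : 0 <= L1dist r s.
Proof. by rewrite fine_ge0// Lnorm_ge0. Qed.

Lemma L1distxx (r : density) : L1dist r r = 0.
Proof.
apply: EFin_inj; rewrite L1distE integral0_eq// => x _.
by rewrite subrr normr0.
Qed.

Lemma L1dist_eq0 (r s : density) : L1dist r s = 0 -> r = s.
Proof.
move=> rs; have rs0 : (\int[mu]_x `|(r x - s x)%:E| = 0)%E.
  by rewrite -L1distE rs.
apply: densityP.
have mrs : measurable_fun setT (fun x => (r x - s x)%:E).
  by apply/measurable_EFinP/measurable_funB; exact: measurable_density.
have /(_ rs0) := (ae_eq_integral_abs mu measurableT mrs).1.
by apply: filterS => x /(_ I)[] /subr0_eq.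
Qed.

Lemma L1dist_sym (r s : density) : L1dist r s = L1dist s r.
Proof.
apply: EFin_inj; rewrite !L1distE; apply: eq_integral => x _.
by rewrite distrC.
Qed.

Lemma L1dist_triangle (s r t : density) : L1dist r t <= L1dist r s + L1dist s t.
Proof.
have mD (a b : density) : measurable_fun setT (fun x => `|a x - b x|%:E).
  apply/measurable_EFinP/measurableT_comp => //.
  by apply: measurable_funB; exact: measurable_density.
rewrite -lee_fin EFinD !L1distE -ge0_integralD//.
apply: ge0_le_integral => //; first by apply: emeasurable_funD.
by move=> x _; rewrite -EFinD lee_fin ler_distD.
Qed.

HB.instance Definition _ := isMetric.Build R density
  L1distxx L1dist_eq0 L1dist_sym L1dist_triangle.

End density.

Section weighted_measure.
Context d (T : measurableType d) (R : realType).
Variable mu : {measure set T -> \bar R}.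
Variable r : density mu.

(* Everywhere nonnegative modification of the density, so that [weighted] below
   is literally a measure; it agrees a.e. with the density (density_pos_ae). *)
Definition density_pos (x : T) : R := Num.max (r x) 0.

Lemma density_pos_ge0 x : 0 <= density_pos x.
Proof. by rewrite le_max lexx orbT. Qed.

Lemma measurable_density_pos : measurable_fun setT density_pos.
Proof. by apply: measurable_maxr => //; exact: measurable_density. Qed.

Lemma density_pos_ae : {ae mu, forall x, density_pos x = r x}.
Proof. by apply: filterS (density_ge0 r) => x rx; exact/max_idPl. Qed.

(* The measure rho dmu. *)
Definition weighted (A : set T) : \bar R := (\int[mu]_(x in A) (density_pos x)%:E)%E.

Let weighted0 : weighted set0 = 0%E.
Proof. by rewrite /weighted integral_set0. Qed.

Let weighted_ge0 A : (0 <= weighted A)%E.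
Proof. by apply: integral_ge0 => x _; rewrite lee_fin density_pos_ge0. Qed.

Let weighted_sigma_additive : semi_sigma_additive weighted.
Proof.
move=> F mF tF mUF; rewrite /weighted ge0_integral_bigcup//.
- apply: is_cvg_ereal_nneg_natsum_cond => n _ _; exact: weighted_ge0.
- apply: measurable_funTS; apply/measurable_EFinP.
  exact: measurable_density_pos.
- by move=> x _; rewrite lee_fin density_pos_ge0.
Qed.

HB.instance Definition _ := isMeasure.Build _ _ _ weighted
  weighted0 weighted_ge0 weighted_sigma_additive.

Import HBNNSimple.

Lemma ge0_integral_weighted (g : T -> \bar R) :
  measurable_fun setT g -> (forall x, 0 <= g x)%E ->
  (\int[weighted]_x g x = \int[mu]_x (g x * (density_pos x)%:E))%E.
Proof.
move=> mg g0.
have mp := measurable_density_pos.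
pose f_ := nnsfun_approx measurableT mg.
transitivity (limn (fun n => \int[weighted]_x (f_ n x)%:E))%E.
  rewrite -monotone_convergence//.
  - apply: eq_integral => y _; apply/esym/cvg_lim => //.
    by apply: cvg_nnsfun_approx.
  - by move=> n; exact/measurable_EFinP/measurable_funP.
  - by move=> n y _; rewrite lee_fin.
  - by move=> y _ m n mn; rewrite lee_fin; exact/lefP/nd_nnsfun_approx.
transitivity (limn (fun n => \int[mu]_x ((f_ n x)%:E * (density_pos x)%:E)))%E;
  last first.
  rewrite -monotone_convergence//.
  - apply: eq_integral => y _; apply/cvg_lim => //.
    rewrite muleC; under eq_fun do rewrite muleC.
    apply: cvgeZl => //.
    by apply: cvg_nnsfun_approx.
  - move=> n; apply: emeasurable_funM; exact/measurable_EFinP.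
  - by move=> n y _; rewrite -EFinM lee_fin mulr_ge0 ?density_pos_ge0.
  - move=> y _ m n mn; rewrite -!EFinM lee_fin ler_wpM2r ?density_pos_ge0//.
    exact/lefP/nd_nnsfun_approx.
congr (limn _); apply/funext => n.
under [LHS]eq_integral do rewrite fimfunE -fsumEFin//.
rewrite ge0_integral_fsum//; last 2 first.
- by move=> y; exact/measurable_EFinP/measurable_funM.
- by move=> y x _; rewrite nnfun_muleindic_ge0.
transitivity (\sum_(k \in range (f_ n))
   \int[mu]_x ((k * \1_(f_ n @^-1` [set k]) x)%:E * (density_pos x)%:E))%E.
  apply: eq_fsbigr => k _; rewrite integralZl_indic_nnsfun// integral_indic//=.
  rewrite setIT /weighted integral_mkcond.
  have [k0|k0] := ltP k 0.
    rewrite preimage_nnfun0// integral0_eq; last first.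
      by move=> x _; rewrite patch_set0.
    rewrite mule0 integral0_eq// => x _.
    by rewrite indic0 mulr0 mul0e.
  rewrite -ge0_integralZl//; last 2 first.
  - apply/(measurable_restrictT _ _).1 => //.
    by apply/measurable_funTS/measurable_EFinP.
  - by move=> x _; rewrite /patch; case: ifP => // _; rewrite lee_fin density_pos_ge0.
  apply: eq_integral => x _; rewrite /patch indicE.
  by case: ifP => _; rewrite ?mulr1 // mulr0 mule0 mul0e.
rewrite -ge0_integral_fsum//.
- apply: eq_integral => x _; rewrite fimfunE -fsumEFin//.
  by rewrite ge0_mule_fsuml// => y; rewrite nnfun_muleindic_ge0.
- move=> y; apply: emeasurable_funM; last exact/measurable_EFinP.
  exact/measurable_EFinP/measurable_funM.
- move=> y x _; rewrite mule_ge0 ?nnfun_muleindic_ge0//.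
  by rewrite lee_fin density_pos_ge0.
Qed.

End weighted_measure.

Section density_transform.
Context d (T : measurableType d) (R : realType).
Variable mu : {measure set T -> \bar R}.
Variable r : density mu.

Local Notation pos := (density_pos r).
Local Notation wmu := (weighted r).

Definition Vspace : set (L2 mu) :=
  [set u | {ae mu, forall x, r x = 0 -> L2_to_fun u x = 0}].

Lemma aeI (nu : {measure set T -> \bar R}) (P Q : T -> Prop) :
  {ae nu, forall x, P x} -> {ae nu, forall x, Q x} ->
  {ae nu, forall x, P x /\ Q x}.
Proof. exact: filterS2. Qed.

Lemma weighted_ae (P : T -> Prop) :
  {ae mu, forall x, P x} -> {ae wmu, forall x, P x}.
Proof.
move=> [A [mA A0 PA]]; exists A; split => //.
apply: null_set_integral => //; apply/measurable_funTS/measurable_EFinP.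
exact: measurable_density_pos.
Qed.

Lemma weighted_ae_neq0 : {ae wmu, forall x, pos x != 0}.
Proof.
have mp := measurable_density_pos r.
exists (pos @^-1` [set 0]); split.
- by rewrite -[X in measurable X]setTI; exact: mp.
- by apply: integral0_eq => x /= ->.
- by move=> x /= /negP; rewrite negbK => /eqP.
Qed.

Lemma ae_weighted (P : T -> Prop) :
  {ae wmu, forall x, P x} -> {ae mu, forall x, pos x != 0 -> P x}.
Proof.
have mp := measurable_density_pos r.
move=> [A [mA A0 PA]].
have mpE D : measurable_fun D (EFin \o pos).
  by apply/measurable_funTS/measurable_EFinP.
have : (\int[mu]_(x in A) `|(EFin \o pos) x| = 0)%E.
  rewrite -[RHS]A0; apply: eq_integral => x _ /=.
  by rewrite ger0_norm// density_pos_ge0.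
move/(ae_eq_integral_abs mu mA (mpE A)).1.
apply: filterS => x px p0; apply: contrapT => nP.
by have [p00] := px (PA _ nP); rewrite p00 eqxx in p0.
Qed.

Lemma measurable_L2_scale (a : T -> R) (f : T -> R[i]) :
    measurable_fun setT a ->
    measurable_fun setT (fun x => complex.Re (f x)) ->
    measurable_fun setT (fun x => complex.Im (f x)) ->
  measurable_fun setT (fun x => complex.Re ((a x)%:C * f x)) /\
  measurable_fun setT (fun x => complex.Im ((a x)%:C * f x)).
Proof.
move=> ma mR mI; split.
  under eq_fun do rewrite ReM /= mul0r subr0; exact: measurable_funM.
under eq_fun do rewrite ImM /= mul0r addr0; exact: measurable_funM.
Qed.

Lemma normc_scale (a : R) (z : R[i]) : 0 <= a ->
  normc (a%:C * z) = a * normc z.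
Proof.
move=> a0; rewrite Normc.normcM (normcE2 a%:C) /= expr0n addr0.
by rewrite sqrtr_sqr ger0_norm.
Qed.

Lemma measurable_sqrt_pos : measurable_fun setT (fun x => Num.sqrt (pos x)).
Proof.
under eq_fun do rewrite -powR12_sqrt ?density_pos_ge0//.
apply: (measurableT_comp (measurable_powR _)); exact: measurable_density_pos.
Qed.

Lemma measurable_sqrt_posV : measurable_fun setT (fun x => (Num.sqrt (pos x))^-1).
Proof.
under eq_fun do rewrite -powR12_sqrt ?density_pos_ge0// -powRN.
apply: (measurableT_comp (measurable_powR _)); exact: measurable_density_pos.
Qed.

Lemma L2norm_fun_U (f : T -> R[i]) : f \in L2_fun wmu ->
  L2norm_fun mu (fun x => (Num.sqrt (pos x))%:C * f x) = L2norm_fun wmu f.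
Proof.
move=> fL; rewrite !L2norm_funE ge0_integral_weighted//.
- congr (_ `^ _)%E; apply: eq_integral => x _.
  rewrite normc_scale ?sqrtr_ge0// exprMn sqr_sqrtr ?density_pos_ge0//.
  by rewrite mulrC EFinM.
- exact: (measurable_normc2 fL).
- by move=> x; rewrite lee_fin sqr_ge0.
Qed.

Lemma Umap_fun_L2 (f : T -> R[i]) : f \in L2_fun wmu ->
  (fun x => (Num.sqrt (pos x))%:C * f x) \in L2_fun mu.
Proof.
move=> fL; have /L2_funP[mR mI fy] := fL.
have [? ?] := measurable_L2_scale measurable_sqrt_pos mR mI.
by apply/L2_funP; split => //; rewrite L2norm_fun_U.
Qed.

Lemma Umap_inv_fun_L2 (u : T -> R[i]) : u \in L2_fun mu ->
  (fun x => ((Num.sqrt (pos x))^-1)%:C * u x) \in L2_fun wmu.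
Proof.
move=> uL; have /L2_funP[mR mI uy] := uL.
have [mR' mI'] := measurable_L2_scale measurable_sqrt_posV mR mI.
apply/L2_funP; split => //; apply: le_lt_trans uy.
have m2 : measurable_fun setT (fun x =>
    (normc (((Num.sqrt (pos x))^-1)%:C * u x) ^+ 2)%:E).
  by apply/measurable_EFinP/measurable_funX/measurable_normc.
rewrite !L2norm_funE gt0_ler_poweR//.
- by rewrite in_itv/= leey integral_ge0// => x _; rewrite lee_fin sqr_ge0.
- by rewrite in_itv/= leey integral_ge0// => x _; rewrite lee_fin sqr_ge0.
rewrite ge0_integral_weighted//; last by move=> x; rewrite lee_fin sqr_ge0.
apply: ge0_le_integral => //.
- by move=> x _; rewrite -EFinM lee_fin mulr_ge0 ?sqr_ge0 ?density_pos_ge0.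
- apply: emeasurable_funM => //.
  by apply/measurable_EFinP; exact: measurable_density_pos.
- exact: (measurable_normc2 uL).
move=> x _; rewrite -EFinM lee_fin normc_scale ?invr_ge0 ?sqrtr_ge0//.
rewrite exprMn exprVn sqr_sqrtr ?density_pos_ge0// mulrAC.
have [->|p0] := eqVneq (pos x) 0; first by rewrite mulr0 mul0r sqr_ge0.
by rewrite mulVf// mul1r.
Qed.

Definition Umap (f : L2 wmu) : L2 mu :=
  \pi_(L2 mu) (MkL2fun (Umap_fun_L2 (L2fun_valP (repr f)))).

(* Since 0^-1 = 0, this is u / sqrt rho on {rho != 0}; it is defined on all of
   L2 mu but inverts Umap only on Vspace (UmapK, Umap_V, Umap_invK). *)
Definition Umap_inv (u : L2 mu) : L2 wmu :=
  \pi_(L2 wmu) (MkL2fun (Umap_inv_fun_L2 (L2fun_valP (repr u)))).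

Lemma Umap_E (f : L2 wmu) :
  {ae mu, forall x, L2_to_fun (Umap f) x = (Num.sqrt (pos x))%:C * L2_to_fun f x}.
Proof. exact: L2_reprE. Qed.

Lemma Umap_inv_E (u : L2 mu) :
  {ae wmu, forall x, L2_to_fun (Umap_inv u) x = ((Num.sqrt (pos x))^-1)%:C * L2_to_fun u x}.
Proof. exact: L2_reprE. Qed.

Lemma Umap_V f : Vspace (Umap f).
Proof.
apply: filterS (aeI (Umap_E f) (density_pos_ae r)) => x [-> ->] ->.
by rewrite sqrtr0 mul0r.
Qed.

Lemma UmapK : cancel Umap Umap_inv.
Proof.
move=> f; apply: L2_to_fun_inj.
have h := aeI (Umap_inv_E (Umap f)) (aeI (weighted_ae (Umap_E f)) weighted_ae_neq0).
apply: filterS h => x [-> [-> p0]]; rewrite mulrA -rmorphM mulVf ?mul1r//.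
by rewrite sqrtr_eq0 -ltNge lt_neqAle eq_sym p0 density_pos_ge0.
Qed.

Lemma Umap_invK u : Vspace u -> Umap (Umap_inv u) = u.
Proof.
move=> uV; apply: L2_to_fun_inj.
have h := aeI (density_pos_ae r) (aeI uV
  (aeI (Umap_E (Umap_inv u)) (ae_weighted (Umap_inv_E u)))).
apply: filterS h => x [px [u0 [-> h]]].
have [p0|p0] := eqVneq (pos x) 0.
  by rewrite p0 sqrtr0 mul0r u0// -px.
rewrite h// mulrA -rmorphM mulfV ?mul1r//.
by rewrite sqrtr_eq0 -ltNge lt_neqAle eq_sym p0 density_pos_ge0.
Qed.

Lemma Umap_norm f : L2norm (Umap f) = L2norm f.
Proof.
apply: EFin_inj; rewrite -[in RHS](reprK f) !L2norm_pi.
exact: L2norm_fun_U (L2fun_valP _).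
Qed.

Lemma Umap_linear : linear Umap.
Proof.
move=> a f g; apply: L2_to_fun_inj.
have h := aeI (aeI (Umap_E f) (Umap_E g)) (aeI (Umap_E (a *: f + g))
  (aeI (L2_to_fun_lin a (Umap f) (Umap g)) (ae_weighted (L2_to_fun_lin a f g)))).
apply: filterS h => x [[fx gx] [-> [-> fg]]]; rewrite fx gx.
have [->|p0] := eqVneq (pos x) 0; first by rewrite sqrtr0 !mul0r mulr0 addr0.
by rewrite fg// mulrDr mulrCA.
Qed.

HB.instance Definition _ := GRing.isLinear.Build R[i] (L2 wmu) (L2 mu) _ Umap Umap_linear.

End density_transform.

Record bounded_op (K : numFieldType) (E : normedModType K) := BoundedOp {
  bounded_op_fun :> {linear E -> E} ;
  bounded_opP : exists M, forall x, `|bounded_op_fun x| <= M * `|x| }.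

Section extension_policy.
Context d (T : measurableType d) (R : realType).
Variable mu : {measure set T -> \bar R}.
Implicit Types (A : forall r : density mu, bounded_op (L2 (weighted r)))
  (At : density mu -> bounded_op (L2 mu)).

(* A_rho^sharp = U_rho A_rho U_rho^-1, meaningful for u in Vspace r. *)
Definition sharp A (r : density mu) (u : L2 mu) : L2 mu :=
  Umap (A r (Umap_inv r u)).

Definition extension_policy A At :=
  forall r u, Vspace r u -> At r u = sharp A r u.

Definition strongly_continuous At :=
  forall (r_ : (density mu)^nat) (r : density mu), r_ k @[k --> \oo] --> r ->
  forall u : L2 mu, At (r_ k) u @[k --> \oo] --> At r u.

(* H x R as a metric space for the sum of the two distances, rather than with
   the library product structure. *)
Definition state := (L2 mu * density mu)%type.
HB.instance Definition _ := Choice.on state.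

Definition state_dist (p q : state) : R :=
  L2norm (p.1 - q.1) + L1dist p.2 q.2.

Lemma state_distxx p : state_dist p p = 0.
Proof.
rewrite /state_dist subrr L1distxx addr0.
by have := normr0 (L2 mu); rewrite L2_normE => -[].
Qed.

Lemma state_dist_eq0 p q : state_dist p q = 0 -> p = q.
Proof.
move=> /eqP; rewrite paddr_eq0 ?L2norm_ge0 ?L1dist_ge0// => /andP[/eqP u0 /eqP r0].
case: p q u0 r0 => [u r] [v s] /= u0 /L1dist_eq0 ->; congr (_, _).
by apply/subr0_eq/normr0_eq0; rewrite L2_normE u0.
Qed.

Lemma state_dist_sym p q : state_dist p q = state_dist q p.
Proof.
rewrite /state_dist L1dist_sym; congr (_ + _).
by have := distrC p.1 q.1; rewrite !L2_normE => -[].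
Qed.

Lemma state_dist_triangle q p s :
  state_dist p s <= state_dist p q + state_dist q s.
Proof.
rewrite /state_dist addrACA lerD ?L1dist_triangle//.
by rewrite -lecR rmorphD -!L2_normE ler_distD.
Qed.

HB.instance Definition _ := isMetric.Build R state
  state_distxx state_dist_eq0 state_dist_sym state_dist_triangle.

Definition induced_map At (p : state) : state := (At p.2 p.1, p.2).

End extension_policy.

Section lebesgue_tuple.
Context {R : realType}.
Local Notation RT := (measurableTypeR R).
Local Open Scope ereal_scope.

(* Lebesgue measure on R^n, represented by n.-tuple R; the library sigma-algebra
   on tuples is generated by the coordinates, i.e. it is the Borel one.  The
   values on boxes are given by lebesgue_tuple_box. *)
Fixpoint lebesgue_tuple n : set (n.-tuple RT) -> \bar R :=
  match n with
  | 0 => \d_([tuple] : 0.-tuple RT)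
  | n'.+1 => fun A => ((lebesgue_measure : set RT -> \bar R) \x^ @lebesgue_tuple n')
      [set p : RT * n'.-tuple RT | A (cons_tuple p.1 p.2)]
  end.

Lemma measurable_cons_tuple n (A : set (n.+1.-tuple RT)) : measurable A ->
  measurable [set p : RT * n.-tuple RT | A (cons_tuple p.1 p.2)].
Proof.
move=> mA; rewrite -[X in measurable X]setTI.
have mc : measurable_fun setT
    (fun p : RT * n.-tuple RT => [the n.+1.-tuple RT of p.1 :: p.2]).
  exact: measurable_cons.
exact: mc measurableT _ mA.
Qed.

Definition measure_axioms n := [/\ @lebesgue_tuple n set0 = 0,
  forall A, 0 <= @lebesgue_tuple n A & semi_sigma_additive (@lebesgue_tuple n)].

Lemma lebesgue_tuple_measure n : measure_axioms n.
Proof.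
elim: n => [|n [m0 mge0 madd]].
  split; [exact: measure0|by move=> A; exact: measure_ge0|].
  exact: measure_semi_sigma_additive.
pose ax := isMeasure.Build _ _ _ (@lebesgue_tuple n) m0 mge0 madd.
pose mn : {measure set (n.-tuple RT) -> \bar R} := HB.pack (@lebesgue_tuple n) ax.
pose P : {measure set (RT * n.-tuple RT) -> \bar R} := lebesgue_measure \x^ mn.
have PE A : @lebesgue_tuple n.+1 A = P [set p : RT * n.-tuple RT | A (cons_tuple p.1 p.2)] by [].
split.
- by rewrite PE; exact: measure0.
- by move=> A; rewrite PE; exact: measure_ge0.
move=> F mF tF mUF; rewrite PE.
apply: (@measure_semi_sigma_additive _ _ _ P (fun k => [set p : RT * n.-tuple RT | F k (cons_tuple p.1 p.2)])).
- by move=> k; exact: measurable_cons_tuple.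
- apply/trivIsetP => i j _ _ ij; apply/seteqP; split => // p [/= Fi Fj].
  have /trivIsetP/(_ i j I I ij) := tF.
  by move/seteqP => [+ _]; apply; split; [exact: Fi|exact: Fj].
- exact: measurable_cons_tuple mUF.
Qed.

HB.instance Definition _ n := isMeasure.Build _ _ _ (@lebesgue_tuple n)
  (let: And3 h _ _ := lebesgue_tuple_measure n in h)
  (let: And3 _ h _ := lebesgue_tuple_measure n in h)
  (let: And3 _ _ h := lebesgue_tuple_measure n in h).

Lemma measurable_box n (B : 'I_n -> set RT) : (forall i, measurable (B i)) ->
  measurable [set x : n.-tuple RT | forall i, B i (tnth x i)].
Proof.
move=> mB.
have -> : [set x : n.-tuple RT | forall i, B i (tnth x i)] =
    \bigcap_(i in [set: 'I_n]) ((fun x : n.-tuple RT => tnth x i) @^-1` B i).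
  by apply/seteqP; split => x /= h i => [_|]; exact: h.
apply: fin_bigcap_measurable => // i _.
by rewrite -[X in measurable X]setTI; exact: measurable_tnth.
Qed.

Lemma lebesgue_tuple_box n (B : 'I_n -> set RT) : (forall i, measurable (B i)) ->
  lebesgue_tuple [set x : n.-tuple RT | forall i, B i (tnth x i)] =
  \prod_(i < n) lebesgue_measure (B i).
Proof.
elim: n B => [|n IHn] B mB.
  by rewrite big_ord0 /= diracE mem_set//=; case.
rewrite big_ord_recl -IHn; last by move=> i; exact: mB.
rewrite -product_measure2E//; last first.
  by apply: (@measurable_box n (fun i => B (lift ord0 i))) => i; exact: mB.
rewrite [LHS]/=; congr (_ _); apply/seteqP; split => [[a x]|[a x]] /=.
  move=> h; split => [|i]; first by have := h ord0; rewrite tnth0.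
  by have := h (lift ord0 i); rewrite tnthS.
move=> [h0 h] i; have [j ->|->] := unliftP ord0 i; last by rewrite tnth0.
by rewrite tnthS.
Qed.

End lebesgue_tuple.

(* Main.v *)
Require Import Defs.
From mathcomp Require Import all_boot all_order all_algebra.
From mathcomp Require Import generic_quotient complex ring lra.
From mathcomp Require Import all_classical all_reals all_analysis.
From mathcomp Require Import measurable_realfun.
Import Order.TTheory GRing.Theory Num.Theory.
Import numFieldNormedType.Exports.

Set Implicit Arguments.
Unset Strict Implicit.
Unset Printing Implicit Defensive.

Local Open Scope classical_set_scope.
Local Open Scope ring_scope.
Local Open Scope quotient_scope.

(* Restricting a continuous induced map to a slice {u} x R gives strong
   continuity.  Conversely, let (u_k, rho_k) -> (u, rho) and write T_k for the
   extended operator at rho_k.  By strong continuity (T_k) converges pointwise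
   on L^2, so it is bounded in operator norm by Banach-Steinhaus, say by M, and
   |T_k u_k - T u| <= M |u_k - u| + |T_k u - T u| -> 0.

   Uniform boundedness is proved by nested balls whose radii shrink at least by
   a factor 4, on the n-th of which some T_k is at least n in norm.  The only completeness needed is that of L^2 for sequences with
   |u_(n+1) - u_n| <= 4^-n: there sum_n 4^n |u_(n+1) - u_n|^2 is integrable,
   hence finite a.e., so u_n converges a.e., and Fatou's lemma transfers the
   norm bounds to the limit. *)

(** * Sequences with geometrically small increments *)

Lemma cvgn_geometric_increments (R : realType) (a : R^nat) (C : R) :
  (forall n, `|a n.+1 - a n| <= C / 2 ^+ n) -> cvgn a.
Proof.
move=> aC; have C0 : 0 <= C.
  apply: le_trans (normr_ge0 (a 1%N - a 0%N)) _.
  by have := aC 0%N; rewrite expr0 divr1.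
have : cvgn (series (telescope a)).
  apply: normed_cvg; apply: (@series_le_cvg _ _ (geometric C 2^-1)).
  - by move=> n /=.
  - by move=> n; rewrite /= mulr_ge0// exprn_ge0// invr_ge0.
  - by move=> n; rewrite /= exprVn; exact: aC.
  - apply: is_cvg_geometric_series.
    by rewrite ger0_norm ?invr_ge0// invf_lt1 ?ltr1n.
rewrite telescopeK => h.
have -> : a = (fun n => (a n - a 0%N) + a 0%N).
  by apply/funext => n; rewrite subrK.
by apply: is_cvgD => //; exact: is_cvg_cst.
Qed.

(** * Real and imaginary parts against the modulus *)

Section complex_numbers.
Context (R : realType).

Lemma normc_Re (z : R[i]) : `|complex.Re z| <= normc z.
Proof.
by rewrite normcE2 -sqrtr_sqr ler_sqrt ?addr_ge0 ?sqr_ge0// lerDl sqr_ge0.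
Qed.

Lemma normc_Im (z : R[i]) : `|complex.Im z| <= normc z.
Proof.
by rewrite normcE2 -sqrtr_sqr ler_sqrt ?addr_ge0 ?sqr_ge0// lerDr sqr_ge0.
Qed.

Lemma ReB (z w : R[i]) : complex.Re (z - w) = complex.Re z - complex.Re w.
Proof. by case: z w => [? ?] [? ?]. Qed.

Lemma ImB (z w : R[i]) : complex.Im (z - w) = complex.Im z - complex.Im w.
Proof. by case: z w => [? ?] [? ?]. Qed.

Lemma normcB2 (z w : R[i]) : normc (z - w) ^+ 2 =
  (complex.Re z - complex.Re w) ^+ 2 + (complex.Im z - complex.Im w) ^+ 2.
Proof. by rewrite normcE2 sqr_sqrtr ?addr_ge0 ?sqr_ge0// ReB ImB. Qed.

End complex_numbers.

(** * Lower limits, as needed for Fatou's lemma *)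

Section limn_einf.
Context (R : realType).

Lemma limn_einf_le (a : (\bar R)^nat) (m : nat) (l : \bar R) :
  (forall n, (m <= n)%N -> (a n <= l)%E) -> (limn_einf a <= l)%E.
Proof.
move=> al; rewrite limn_einf_lim.
apply: lime_le => //; first exact: is_cvg_einfs.
apply: nearW => n; apply: (@le_trans _ _ (a (maxn n m))).
  by apply: ereal_inf_lbound; exists (maxn n m) => //=; rewrite leq_maxl.
by apply: al; rewrite leq_maxr.
Qed.

Lemma limn_einf_ge0 (a : (\bar R)^nat) :
  (forall n, (0 <= a n)%E) -> (0 <= limn_einf a)%E.
Proof.
move=> a0; rewrite limn_einf_lim; apply: lime_ge; first exact: is_cvg_einfs.
by apply: nearW => n; apply: le_ereal_inf_tmp => _ [k _ <-].
Qed.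

Lemma measurable_fun_limn_einf d (T : measurableType d)
    (h : (T -> \bar R)^nat) :
    (forall n, measurable_fun setT (h n)) ->
  measurable_fun setT (fun x => limn_einf (h^~ x)).
Proof.
move=> mh; apply: measurableT_comp => //.
by apply: measurable_fun_limn_esup => n; exact: measurableT_comp.
Qed.

End limn_einf.

(** * Norm inequalities in L^2 *)

Section L2_operators.
Context d (T : measurableType d) (R : realType).
Variable mu : {measure set T -> \bar R}.
Local Notation H := (L2 mu).

Lemma L2normZ (a : R) (u : H) : L2norm (a%:C%C *: u) = `|a| * L2norm u.
Proof.
apply: complexI; rewrite rmorphM -!L2_normE normrZ; congr (_ * _).
by rewrite normc_def /= expr0n addr0 sqrtr_sqr.
Qed.

Lemma L2norm0 : L2norm (0 : H) = 0.
Proof. by apply: complexI; rewrite -L2_normE normr0. Qed.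

Lemma L2norm_subC (u v : H) : L2norm (u - v) = L2norm (v - u).
Proof. by apply: complexI; rewrite -!L2_normE distrC. Qed.

Lemma L2normD (u v : H) : L2norm (u + v) <= L2norm u + L2norm v.
Proof. by rewrite -lecR rmorphD -!L2_normE ler_normD. Qed.

Lemma L2norm_triangle (v u w : L2 mu) :
  L2norm (u - w) <= L2norm (u - v) + L2norm (v - w).
Proof. by rewrite -lecR rmorphD -!L2_normE ler_distD. Qed.

(** The factor 2 survives induction: r_n + 2 r_(n+1) <= (1 + 2/4) r_n <= 2 r_n. *)
Lemma L2norm_dist_geometric (x : H^nat) (r : R^nat) n m :
    (forall n, L2norm (x n.+1 - x n) <= r n) -> (forall n, r n.+1 <= r n / 4) ->
  (n <= m)%N -> L2norm (x m - x n) <= 2 * r n.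
Proof.
move=> xr r4 nm; rewrite -(subnK nm).
move: (m - n)%N => j; elim: j n {nm} => [|j ih] n.
  rewrite add0n; have := xr n; have := L2norm_ge0 (x n.+1 - x n).
  rewrite subrr L2norm0; lra.
rewrite addSnnS; apply: le_trans (L2norm_triangle (x n.+1) _ _) _.
have := ih n.+1; have := xr n; have := r4 n.
have := L2norm_ge0 (x n.+1 - x n); lra.
Qed.

(** * Limits of rapidly Cauchy sequences in L^2 *)

Lemma L2norm_sqrE (u : L2 mu) :
  (\int[mu]_x (normc (L2_to_fun u x) ^+ 2)%:E = (L2norm u ^+ 2)%:E)%E.
Proof.
have e : (L2norm u)%:E = L2norm_fun mu (L2_to_fun u).
  by rewrite -[in LHS](reprK u) L2norm_pi.
have : (0 <= \int[mu]_x (normc (L2_to_fun u x) ^+ 2)%:E)%E.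
  by apply: integral_ge0 => x _; rewrite lee_fin sqr_ge0.
move: e; rewrite L2norm_funE; case: (integral _ _ _) => [r||]//=.
- rewrite lee_fin => + r0; rewrite powR12_sqrt// => -[->].
  by rewrite sqr_sqrtr.
- by rewrite invr_eq0 pnatr_eq0.
Qed.

Lemma L2_to_funB (u v : L2 mu) :
  {ae mu, forall x, L2_to_fun (u - v) x = L2_to_fun u x - L2_to_fun v x}.
Proof.
have -> : u - v = (-1) *: v + u by rewrite scaleN1r addrC.
by apply: filterS (L2_to_fun_lin (-1) v u) => x ->; rewrite mulN1r addrC.
Qed.

Lemma measurable_L2_normc2 (u : L2 mu) :
  measurable_fun setT (fun x => (normc (L2_to_fun u x) ^+ 2)%:E).
Proof. exact: measurable_normc2 (L2fun_valP (repr u)). Qed.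

Lemma L2_fast_cauchy_ae (u : (L2 mu)^nat) :
    (forall n, L2norm (u n.+1 - u n) <= (4 ^+ n)^-1) ->
  {ae mu, forall x, exists C : R, forall n,
    normc (L2_to_fun (u n.+1) x - L2_to_fun (u n) x) <= C / 2 ^+ n}.
Proof.
move=> u4.
pose g n x : \bar R := (4 ^+ n * normc (L2_to_fun (u n.+1 - u n) x) ^+ 2)%:E.
have g0 n x : (0 <= g n x)%E by rewrite lee_fin mulr_ge0 ?sqr_ge0 ?exprn_ge0.
have mg n : measurable_fun setT (g n).
  apply/measurable_EFinP/measurable_funM => //.
  exact/measurable_EFinP/measurable_L2_normc2.
pose G x : \bar R := (\sum_(0 <= n <oo) g n x)%E.
have mG : measurable_fun setT G.
  exact: ge0_emeasurable_sum.
have iG : (\int[mu]_x G x <= 2%:E)%E.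
  (* The n-th integral is at most 4^n (4^-n)^2 = 4^-n <= 2^-n = 2 / 2^(n+1), and these last terms
     sum to 2. *)
  rewrite integral_nneseries//; apply: le_trans (epsilon_trick0 xpredT _) => //.
  apply: lee_nneseries => [n _ _|n _]; first exact: integral_ge0.
  rewrite /g; under eq_integral do rewrite EFinM.
  rewrite ge0_integralZl//; last 2 first.
  - exact: measurable_L2_normc2.
  - by move=> x _; rewrite lee_fin sqr_ge0.
  rewrite L2norm_sqrE -EFinM lee_fin natrX (exprS _ n) invfM mulVKf//.
  have p4 : 0 < 4 ^+ n :> R by rewrite exprn_gt0.
  apply: (@le_trans _ _ (4 ^+ n)^-1).
    rewrite -ler_pdivlMl// -expr2 -exprVn.
    by rewrite lerXn2r ?nnegrE ?L2norm_ge0 ?invr_ge0 ?exprn_ge0 ?exprVn.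
  by rewrite lef_pV2 ?posrE ?exprn_gt0// lerXn2r ?nnegrE// ler_nat.
have : mu.-integrable setT G.
  apply/integrableP; split => //.
  under eq_integral do rewrite gee0_abs ?nneseries_ge0//.
  exact: le_lt_trans iG (ltry _).
move=> /integrable_ae -/(_ measurableT).
have : {ae mu, forall x n, L2_to_fun (u n.+1 - u n) x =
    L2_to_fun (u n.+1) x - L2_to_fun (u n) x}.
  by apply/ae_foralln => n; exact: L2_to_funB.
apply: filterS2 => x ux /(_ I) Gx.
(* Each single term 4^n |u_(n+1) - u_n|^2 is at most [G x]; take square roots. *)
exists (Num.sqrt (fine (G x))) => n.
rewrite ler_pdivlMr ?exprn_gt0// -ux mulrC.
rewrite -[leLHS]ger0_norm ?mulr_ge0 ?normc_ge0// -sqrtr_sqr ler_wsqrtr//.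
rewrite exprMn -exprM mulnC exprM -natrX -lee_fin fineK//.
have := @nneseries_lim_ge _ (g^~ x) xpredT 0 n.+1 (fun k _ _ => g0 k x).
apply: le_trans; rewrite big_nat_recr//= leeDr// sume_ge0//.
Qed.

(** The limit is described by the tail bounds it inherits: Fatou yields this form directly, and it
    places the limit in every nested ball. *)
Lemma L2_fast_cauchy_limit (u : (L2 mu)^nat) :
    (forall n, L2norm (u n.+1 - u n) <= (4 ^+ n)^-1) ->
  exists v : L2 mu, forall m e,
    (forall n, (m <= n)%N -> L2norm (u n - u m) <= e) -> L2norm (v - u m) <= e.
Proof.
move=> u4.
have geo4 n : (4 ^+ n.+1)^-1 <= (4 ^+ n)^-1 / 4 :> R by rewrite exprSr invfM.
pose f n := L2_to_fun (u n).
have mf n := L2_funP _ _ (L2fun_valP (repr (u n))).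
(* [limn_esup] rather than [limn]: it is measurable in [x] even though the
   sequences converge only almost everywhere. *)
pose limf (p : R[i] -> R) x := fine (limn_esup (fun n => (p (f n x))%:E)).
have mlimf p : (forall n, measurable_fun setT (fun x => p (f n x))) ->
    measurable_fun setT (limf p).
  move=> mp; apply: (measurableT_comp (@fine_measurable _ _ measurableT)).
  by apply: measurable_fun_limn_esup => n; exact/measurable_EFinP.
pose F x : R[i] := Complex (limf (@complex.Re R) x) (limf (@complex.Im R) x).
have mRF : measurable_fun setT (fun x => complex.Re (F x)).
  by apply: mlimf => n; have [] := mf n.
have mIF : measurable_fun setT (fun x => complex.Im (F x)).
  by apply: mlimf => n; have [] := mf n.
(* Where the sequence converges, the upper limit is the true limit; [p] stands for the real or the
   imaginary part. *)
have limfE p x C : (forall z w, p (z - w) = p z - p w) ->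
    (forall z, `|p z| <= normc z) ->
    (forall n, normc (f n.+1 x - f n x) <= C / 2 ^+ n) ->
    p (f n x) @[n --> \oo] --> limf p x.
  move=> pB pn fC; have cp : cvgn (fun n => p (f n x)).
    apply: cvgn_geometric_increments => n.
    by rewrite -pB; exact: le_trans (fC n).
  have ce : (p (f n x))%:E @[n --> \oo] --> (limn (fun n => p (f n x)))%:E.
    by apply: cvg_EFin => //; exact: nearW.
  by rewrite /limf (cvg_limn_einf_sup ce).2.
have cvF : {ae mu, forall x m,
    (normc (f n x - f m x) ^+ 2)%:E @[n --> \oo] -->
    (normc (F x - f m x) ^+ 2)%:E}.
  apply: filterS (L2_fast_cauchy_ae u4) => x [C fC] m.
  have cR : complex.Re (f n x) @[n --> \oo] --> complex.Re (F x).
    by apply: limfE fC; [exact: ReB|exact: normc_Re].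
  have cI : complex.Im (f n x) @[n --> \oo] --> complex.Im (F x).
    by apply: limfE fC; [exact: ImB|exact: normc_Im].
  apply: cvg_EFin; first exact: nearW.
  rewrite normcB2 /=; under eq_fun do rewrite /= normcB2.
  by apply: cvgD; rewrite expr2; under eq_fun do rewrite expr2;
    apply: cvgM; apply: cvgB => //; exact: cvg_cst.
have mFB m : measurable_fun setT (fun x => complex.Re (F x - f m x)) /\
    measurable_fun setT (fun x => complex.Im (F x - f m x)).
  have [mR mI _] := mf m.
  split; first by under eq_fun do rewrite ReB; exact: measurable_funB mRF mR.
  by under eq_fun do rewrite ImB; exact: measurable_funB mIF mI.
(* Fatou: a.e. |F - f_m|^2 is the lower limit of |u_n - u_m|^2, and only the indices n >= m matter
   for it. *)
have FB m e : (forall n, (m <= n)%N -> L2norm (u n - u m) <= e) ->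
    (\int[mu]_x (normc (F x - f m x) ^+ 2)%:E <= (e ^+ 2)%:E)%E.
  move=> ume; have [mR mI] := mFB m.
  pose h n x := (normc (L2_to_fun (u n - u m) x) ^+ 2)%:E.
  have mh n : measurable_fun setT (h n) by exact: measurable_L2_normc2.
  rewrite (@ge0_ae_eq_integral _ _ _ mu setT _ (fun x => limn_einf (h^~ x)))//.
  - apply: le_trans (fatou _ _ _ _) _ => //.
      by move=> n x _; rewrite lee_fin sqr_ge0.
    apply: (@limn_einf_le _ _ m) => n mn.
    rewrite L2norm_sqrE lee_fin lerXn2r ?nnegrE ?L2norm_ge0 ?ume//.
    by apply: le_trans (ume n mn); exact: L2norm_ge0.
  - by apply/measurable_EFinP/measurable_funX/measurable_normc.
  - exact: measurable_fun_limn_einf.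
  - by move=> x _; rewrite lee_fin sqr_ge0.
  - by move=> x _; apply: limn_einf_ge0 => n; rewrite lee_fin sqr_ge0.
  have : {ae mu, forall x n, L2_to_fun (u n - u m) x = f n x - f m x}.
    by apply/ae_foralln => n; exact: L2_to_funB.
  apply: filterS2 cvF => x cx ux _.
  rewrite /h; under eq_fun do rewrite ux.
  by rewrite (cvg_limn_einf_sup (cx m)).1.
(* Fatou controls differences, so F - f_0 is put into L^2 (all u_n lie within 2 of u_0) and u_0 is
   added back. *)
have DL : (fun x => F x - f 0%N x) \in L2_fun mu.
  have [mR mI] := mFB 0%N; apply/L2_funP; split => //.
  have I2 := FB 0%N _ (fun n => L2norm_dist_geometric u4 geo4).
  by rewrite L2norm_funE; apply: poweR_lty; exact: le_lt_trans I2 (ltry _).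
exists (\pi_(L2 mu) (MkL2fun DL) + u 0%N) => m e ume.
have e0 : 0 <= e by apply: le_trans (ume m (leqnn m)); exact: L2norm_ge0.
rewrite -(@ler_pXn2r _ 2%N isT) ?nnegrE ?L2norm_ge0// -lee_fin -L2norm_sqrE.
rewrite (le_trans _ (FB m e ume))// le_eqVlt; apply/orP; left; apply/eqP.
have [mR mI] := mFB m.
apply: ge0_ae_eq_integral => //; first exact: measurable_L2_normc2.
- by apply/measurable_EFinP/measurable_funX/measurable_normc.
- by move=> x _; rewrite lee_fin sqr_ge0.
- by move=> x _; rewrite lee_fin sqr_ge0.
set D := \pi_(L2 mu) _.
have DE := L2_to_fun_lin 1 D (u 0%N).
have BE := L2_to_funB (D + u 0%N) (u m).
have h := aeI BE (aeI DE (L2_reprE (MkL2fun DL))).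
apply: filterS h => x; rewrite scale1r => -[-> [-> ->]] _ /=.
by rewrite mul1r subrK.
Qed.

(** * Uniform boundedness of operator sequences *)

(** The constant in [bounded_op] lives in [R[i]]; as M |u| >= |B u| >= 0, its modulus is a real
    nonnegative bound. *)
Lemma bounded_op_L2norm (B : bounded_op H) :
  exists2 C : R, 0 <= C & forall u, L2norm (B u) <= C * L2norm u.
Proof.
have [M BM] := bounded_opP B.
exists (normc M); first exact: normc_ge0.
move=> u; rewrite -lecR rmorphM -!L2_normE.
have Mu : 0 <= M * `|u| by apply: le_trans (BM u).
by apply: le_trans (BM u) _; rewrite -[leLHS]ger0_norm// normrM normr_id.
Qed.

Section uniform_boundedness.
Variable B : nat -> bounded_op H.

(** Rescale a bad vector for the constant N / r to w' of norm r, so that |B_k w'| >= N. As 2 w' = (x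
    + w') + (w' - x), the image of x + w' or of x - w' has norm at least N. *)
Lemma bounded_op_large_on_ball (N r : R) (x : H) : 0 <= N -> 0 < r ->
    (forall M, exists k u, M * L2norm u < L2norm (B k u)) ->
  exists k x', L2norm (x' - x) <= r /\ N <= L2norm (B k x').
Proof.
move=> N0 r0 /(_ (N / r))[k [w Nw]].
have [C C0 BC] := bounded_op_L2norm (B k).
have w0 : 0 < L2norm w.
  rewrite lt_neqAle L2norm_ge0 andbT; apply/eqP => w0.
  by have := lt_le_trans Nw (BC w); rewrite -w0 !mulr0 ltxx.
pose a := r / L2norm w; pose w' := a%:C%C *: w.
have a0 : 0 < a by rewrite divr_gt0.
have w'r : L2norm w' = r by rewrite L2normZ gtr0_norm// divfK// gt_eqF.
have Bw' : N <= L2norm (B k w').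
  rewrite linearZ L2normZ gtr0_norm// mulrC -ler_pdivrMr//.
  apply: ltW; apply: le_lt_trans Nw; rewrite /a invf_div mulrA; lra.
have Bxw : 2 * N <= L2norm (B k (x + w')) + L2norm (B k (w' - x)).
  apply: le_trans (L2normD _ _); rewrite -linearD.
  rewrite (_ : x + w' + (w' - x) = 2%:C%C *: w').
    by rewrite linearZ L2normZ ger0_norm// ler_wpM2l.
  rewrite addrC addrA subrK (_ : 2%:C%C = 2%:R); first by rewrite scaler_nat.
  by rewrite rmorph_nat.
have [Nx|Nx] := leP N (L2norm (B k (x + w'))).
  by exists k, (x + w'); rewrite addrC addKr w'r.
exists k, (x - w'); split.
  by rewrite addrC addKr -sub0r L2norm_subC subr0 w'r.
rewrite -(opprB w') linearN -sub0r L2norm_subC subr0; lra.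
Qed.

(** Reach N + 1 at the centre; within 1 / (C + 1) of it the image moves by at most 1. The doubled
    ball leaves room for all later centres and their limit. *)
Lemma bounded_op_large_on_subball (N r : R) (x : H) : 0 <= N -> 0 < r ->
    (forall M, exists k u, M * L2norm u < L2norm (B k u)) ->
  exists x' r', [/\ L2norm (x' - x) <= r, 0 < r', r' <= r / 4 & exists k,
    forall y, L2norm (y - x') <= 2 * r' -> N <= L2norm (B k y)].
Proof.
move=> N0 r0 Bu.
have [k [x' [x'r NB]]] := bounded_op_large_on_ball x (addr_ge0 N0 ler01) r0 Bu.
have [C C0 BC] := bounded_op_L2norm (B k).
have C1 : 0 < 2 * (C + 1) by lra.
exists x', (Num.min (r / 4) (2 * (C + 1))^-1); split => //.
- by rewrite lt_min divr_gt0// invr_gt0.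
- by rewrite ge_min lexx.
exists k => y yx'.
have yC : L2norm (y - x') <= (C + 1)^-1.
  apply: (le_trans yx'); rewrite -ler_pdivlMl// -invfM.
  by rewrite ge_min lexx orbT.
have yB : L2norm (B k (x' - y)) <= 1.
  rewrite (le_trans (BC _))// L2norm_subC (le_trans (ler_wpM2l C0 yC))//.
  by rewrite ler_pdivrMr; lra.
have := L2normD (B k (x' - y)) (B k y).
rewrite -linearD subrK; lra.
Qed.

Lemma L2_uniform_boundedness :
    (forall u, exists M, forall k, L2norm (B k u) <= M) ->
  exists M, forall k u, L2norm (B k u) <= M * L2norm u.
Proof.
move=> Bpt; apply: contrapT => /forallNP Bu.
have {}Bu M : exists k u, M * L2norm u < L2norm (B k u).
  have /existsNP[k /existsNP[u /negP]] := Bu M.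
  by rewrite -ltNge; exists k, u.
(* A state is a level with a centre and a radius. The guard on the radius makes the choice total;
   without positivity [p.2] is a dummy. *)
have step (p : nat * (H * R)) : exists q : H * R, 0 < p.2.2 ->
    [/\ L2norm (q.1 - p.2.1) <= p.2.2, 0 < q.2, q.2 <= p.2.2 / 4 & exists k,
      forall y, L2norm (y - q.1) <= 2 * q.2 -> p.1%:R <= L2norm (B k y)].
  have [r0|] := ltP 0 p.2.2; last by exists p.2 => //; lra.
  have [x' [r' h]] := bounded_op_large_on_subball p.2.1 (ler0n R p.1) r0 Bu.
  by exists (x', r').
have [F FP] := choice step.
pose s := fix s n := if n is m.+1 then F (m, s m) else (0 : H, 1 : R).
have s0 n : 0 < (s n).2.
  by elim: n => [|n ih]; [exact: ltr01|have [] := FP (n, s n) ih].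
have sP n := FP (n, s n) (s0 n).
have sx n : L2norm ((s n.+1).1 - (s n).1) <= (s n).2 by have [] := sP n.
have sr n : (s n.+1).2 <= (s n).2 / 4 by have [] := sP n.
have s4 n : (s n).2 <= (4 ^+ n)^-1.
  elim: n => [|n ih]; first by rewrite expr0 invr1.
  by rewrite (le_trans (sr n))// exprSr invfM ler_wpM2r.
have [v vP] := @L2_fast_cauchy_limit (fun n => (s n).1)
  (fun n => le_trans (sx n) (s4 n)).
have [M BM] := Bpt v.
(* Level n is attained on ball n + 1, hence the successor index below; this level exceeds |M|. *)
have [_ _ _ [k Bk]] := sP (Num.bound `|M|).
have vs n : L2norm (v - (s n).1) <= 2 * (s n).2.
  by apply: vP => m nm; exact: (L2norm_dist_geometric sx sr nm).
have := le_trans (Bk v (vs (Num.bound `|M|).+1)) (BM k); rewrite /= leNgt.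
by rewrite (le_lt_trans (ler_norm _))// archi_boundP.
Qed.

End uniform_boundedness.

(** * Convergence in terms of real distances *)

(** Radii in the normed space are elements of [R[i]], but a positive one has zero imaginary part. *)
Lemma L2_cvgP (I : Type) (G : set_system I) (FG : Filter G)
    (f : I -> H) (u : H) :
  f i @[i --> G] --> u <->
  (forall e : R, 0 < e -> \forall i \near G, L2norm (u - f i) < e).
Proof.
split=> [/cvgrPdist_lt fu e e0|fu].
  have := fu e%:C%C; rewrite ltcR => /(_ e0).
  by apply: filterS => i; rewrite L2_normE ltcR.
apply/cvgrPdist_lt => -[a b]; rewrite ltcE /= => /andP[/eqP b0 a0].
by apply: filterS (fu a a0) => i fi; rewrite L2_normE ltcE /= b0 eqxx.
Qed.

Lemma density_cvgP (I : Type) (G : set_system I) (FG : Filter G)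
    (f : I -> density mu) (r : density mu) :
  f i @[i --> G] --> r <->
  (forall e : R, 0 < e -> \forall i \near G, L1dist r (f i) < e).
Proof. exact: metricType_numDomainType.cvgrPdist_lt. Qed.

Lemma state_cvgP (I : Type) (G : set_system I) (FG : Filter G)
    (f : I -> state mu) (p : state mu) :
  f i @[i --> G] --> p <->
  (forall e : R, 0 < e -> \forall i \near G, state_dist p (f i) < e).
Proof. exact: metricType_numDomainType.cvgrPdist_lt. Qed.

Lemma cvgn_bounded_op_uniform (B : nat -> bounded_op H) (B0 : bounded_op H) :
    (forall u, B k u @[k --> \oo] --> B0 u) ->
  exists M, forall k u, L2norm (B k u) <= M * L2norm u.
Proof.
move=> BB; apply: L2_uniform_boundedness => u.
have /cvg_seq_bounded[M [Mr BM]] : cvgn (fun k => B k u).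
  by apply/cvg_ex; exists (B0 u).
(* Boundedness gives the estimate only for constants strictly above M. *)
exists (complex.Re (M + 1)) => k.
have := BM (M + 1) _ k I; rewrite ltrDl ltr01 => /(_ isT).
by rewrite /= L2_normE lecE => /andP[].
Qed.

(** * Joint continuity versus strong continuity *)

Lemma continuous_induced_mapP (At : density mu -> bounded_op H) :
  continuous (induced_map At) <-> strongly_continuous At.
Proof.
split=> [cA r_ r rr u|sA p].
  have ur : ((u, r_ k) : state mu) @[k --> \oo] --> ((u, r) : state mu).
    apply/state_cvgP => e e0; move/density_cvgP: rr => /(_ e e0).
    by apply: filterS => k; rewrite /state_dist /= subrr L2norm0 add0r.
  have /state_cvgP cu := cvg_comp _ _ ur (cA (u, r)).
  apply/L2_cvgP => e e0; apply: filterS (cu e e0) => k.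
  by apply: le_lt_trans; rewrite lerDl L1dist_ge0.
apply/(@state_cvgP _ (nbhs p)) => e e0; apply: contrapT => nearA.
(* Strong continuity speaks of sequences only, so a failure of continuity at [p] is turned into a
   sequence q_k -> p whose images stay at distance at least e. *)
have bad k : exists q : state mu, state_dist p q < k.+1%:R^-1 /\
    e <= state_dist (induced_map At p) (induced_map At q).
  apply: contrapT => /forallNP good; apply: nearA.
  have k0 : 0 < k.+1%:R^-1 :> R by rewrite invr_gt0.
  have /(@state_cvgP _ (nbhs p))/(_ _ k0) := @cvg_id _ (nbhs p).
  apply: filterS => q pq; rewrite ltNge; apply/negP => eq.
  by apply: (good q).
have [q qP] := choice bad.
have near_dist e' : 0 < e' -> \forall k \near \oo, state_dist p (q k) < e'.
  move=> e'0; have := near_infty_natSinv_lt (PosNum e'0).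
  by apply: filterS => k; apply: lt_trans; have [] := qP k.
have qr : (q k).2 @[k --> \oo] --> p.2.
  apply/density_cvgP => e' /near_dist; apply: filterS => k.
  by apply: le_lt_trans; rewrite lerDr L2norm_ge0.
have AB := sA _ _ qr.
have [M AM] := cvgn_bounded_op_uniform AB.
have M1 : 0 < `|M| + 1 by rewrite ltr_wpDl.
(* The error has three parts, each below e / 3: moving the vector under the operator at q_k, moving
   the operator at the fixed vector, and moving the density. M may be zero or negative, hence |M| +
   1. *)
have d0 : 0 < e / 3 / (`|M| + 1) by rewrite !divr_gt0.
have e3 : 0 < e / 3 by rewrite divr_gt0.
have /L2_cvgP/(_ _ e3) n1 := AB p.1.
have [k [kA [kM ke]]] :=
  filter_ex (filterI n1 (filterI (near_dist _ d0) (near_dist _ e3))).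
have [_] := qP k; apply/negP; rewrite -ltNge /state_dist /=.
have pq1 : L2norm (p.1 - (q k).1) < e / 3 / (`|M| + 1).
  by apply: le_lt_trans kM; rewrite lerDl L1dist_ge0.
have pq2 : L1dist p.2 (q k).2 < e / 3.
  by apply: le_lt_trans ke; rewrite lerDr L2norm_ge0.
have Apq : L2norm (At (q k).2 p.1 - At (q k).2 (q k).1) < e / 3.
  rewrite -linearB; apply: le_lt_trans (AM k _) _.
  rewrite ltr_pdivlMr// in pq1; apply: le_lt_trans pq1.
  rewrite mulrC ler_wpM2l ?L2norm_ge0//; have := ler_norm M; lra.
have := L2norm_triangle (At (q k).2 p.1) (At p.2 p.1) (At (q k).2 (q k).1); lra.
Qed.

End L2_operators.

Theorem theorem7p3 (R : realType) (n : nat) (hn : (0 < n)%N)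
    (A : forall r : density (@lebesgue_tuple R n), bounded_op (L2 (weighted r)))
    (At : density (@lebesgue_tuple R n) -> bounded_op (L2 (@lebesgue_tuple R n)))
    (hAt : extension_policy A At) :
  continuous (induced_map At) <-> strongly_continuous At.
Proof. exact: continuous_induced_mapP. Qed.
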